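(* There exists a (randomized) streaming algorithm that, given $n$ arms arriving one by one in a stream in arbitrary order, an approximation parameter $\varepsilon\in(0,1)$, and a confidence parameter $\delta\in(0,1)$, with probability at least $1-\delta$ finds an $\varepsilon$-best arm using a memory of $O(\log^{*}(n))$ arms and $O\!\left(\frac{n}{\varepsilon^2}\cdot\log(1/\delta)\right)$ arm pulls.
   Context: Stochastic multi-armed bandits. There are $n$ arms; each pull of $\mathrm{arm}_i$ yields an independent reward in $[0,1]$ drawn from an unknown distribution with mean $\mu_i\in[0,1]$. An arm $\mathrm{arm}_i$ is an $\varepsilon$-best arm if $\mu_i\ge\max_j\mu_j-\varepsilon$. No assumption is made on the gap between the largest and second largest means. The values $n,\varepsilon,\delta$ are known to the algorithm. Streaming model. The arms arrive one by one in a stream. At any time the algorithm may pull only the currently arriving arm or an arm explicitly stored in its memory; an arm that is not stored, or that is removed from memory, can no longer be pulled or recovered. The memory is the maximum number of arms stored at any point (auxiliary information such as counters and recorded empirical rewards is not counted). At the end of the stream the algorithm outputs one arm. $\log^{*}(n)$ is the iterated logarithm (the number of times $\log_2$ must be applied to $n$ before the result is at most $1$), understood as at least $1$ in the memory bound. $O(\cdot)$ hides absolute constants. *)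

(* Defs.v *)
From HB Require Import structures.
From mathcomp Require Import all_boot all_order all_algebra all_fingroup.
From mathcomp Require Import all_classical all_reals all_analysis.
From mathcomp Require Import measurable_realfun.

Set Implicit Arguments.
Unset Strict Implicit.
Unset Printing Implicit Defensive.
Import Order.TTheory GRing.Theory Num.Theory.
Import numFieldNormedType.Exports.
Local Open Scope classical_set_scope.
Local Open Scope ring_scope.

Definition log2 (R : realType) (x : R) : R := ln x / ln 2.

Lemma ex_iter_log2 (R : realType) (n : nat) :
  exists k, iter k (@log2 R) n%:R <= 1.
Proof.
have ln2 : 0 < ln 2 :> R by rewrite ln_gt0 // ltr1n.
suff H (m : nat) (x : R) : x <= 2 ^+ m -> exists k, iter k (@log2 R) x <= 1.
  apply: (H n); rewrite -natrX ler_nat; exact/ltnW/ltn_expl.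
elim: m x => [|m IH] x; first by rewrite expr0 => x1; exists 0%N.
move=> xm; have [x1|x1] := leP x 1; first by exists 0%N.
have [|k hk] := IH (log2 x); last by exists k.+1; rewrite iterSr.
have : log2 x <= m.+1%:R.
  rewrite /log2 ler_pdivrMr // mulr_natl -lnXn // ler_ln // posrE ?exprn_gt0 //.
  exact: lt_trans x1.
move=> /le_trans; apply; rewrite -natrX ler_nat; exact: ltn_expl.
Qed.

(* The iterated logarithm; [R] is only used to compute real logarithms. *)
Definition logstar (R : realType) (n : nat) : nat := ex_minn (ex_iter_log2 R n).

(* Arms are named by their (0-based) position in the stream. [Pull] names the
   arm to be pulled, [Store] stores the currently arriving arm, [Next] moves on
   to the next arrival and [Answer] outputs an arm. *)
Inductive stream_action (n : nat) : Type :=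
| Pull of 'I_n
| Store
| Discard of 'I_n
| Next
| Answer of 'I_n.
Arguments Store {n}.
Arguments Next {n}.

Lemma finite_stream_action (n : nat) : finite_set [set: stream_action n].
Proof.
pose f (x : option (option 'I_n + 'I_n + 'I_n)) : stream_action n := match x with
  | None => Next | Some (inl (inl None)) => Store | Some (inl (inl (Some i))) => Pull i
  | Some (inl (inr i)) => Discard i | Some (inr i) => Answer i end.
rewrite (_ : setT = f @` setT); first exact/finite_image/finite_finset.
apply/seteqP; split=> // -[i||i||i] _.
- by exists (Some (inl (inl (Some i)))).
- by exists (Some (inl (inl None))).
- by exists (Some (inl (inr i))).
- by exists None.
- by exists (Some (inr i)).
Qed.

(* A randomized streaming algorithm for n arms is a machine with an arbitrary
   measurable space of internal states (counters, recorded rewards, ...), which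
   does not count as memory. The state determines the next action; the next
   state is then drawn, with the algorithm's own randomness, from a probability
   kernel applied to the state and to the reward just observed (0 if there is
   none). The algorithm knows which actions it took, so it can keep track of its
   position in the stream and of the stored arms in its internal state. *)
Record streaming_alg (R : realType) (n : nat) := StreamingAlg {
  alg_display : measure_display ;
  alg_state : measurableType alg_display ;
  alg_init : alg_state ;
  alg_action : alg_state -> stream_action n ;
  measurable_alg_action : forall a, measurable (alg_action @^-1` [set a]) ;
  alg_next : R.-pker (alg_state * R) ~> alg_state }.

(* [pos] is the position of the currently arriving arm, and is n once the
   stream has ended; [memory] is the set of stored arms, [peak] the maximum
   number of arms stored so far and [pulls] the number of arm pulls so far. *)
Record env (n : nat) := Env {
  pos : nat ;
  memory : {set 'I_n} ;
  peak : nat ;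
  pulls : nat ;
  output : option 'I_n }.

Definition env0 (n : nat) : env n := Env 0 finset.set0 0 0 None.

Definition can_pull (n : nat) (w : env n) (i : 'I_n) : bool :=
  (output w == None) && ((i \in memory w) || (i == pos w :> nat)).

(* Forbidden actions (pulling an arm which is neither arriving nor stored,
   answering before the end of the stream or with an arm that is not stored,
   acting after having answered) have no effect. *)
Definition env_step (n : nat) (w : env n) (a : stream_action n) : env n :=
  let: Env t M pk q o := w in
  if o is Some _ then w else
  match a with
  | Pull i => if can_pull w i then Env t M pk q.+1 None else w
  | Store => if insub t is Some i
             then Env t (i |: M)%SET (maxn pk #|(i |: M)%SET|) q None else w
  | Discard i => Env t (M :\ i)%SET pk q None
  | Next => if (t < n)%N then Env t.+1 M pk q None else w
  | Answer i => if (t == n) && (i \in M) then Env t M pk q (Some i) else w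
  end.

Section run.
Variables (R : realType) (n : nat).
Variable nu : 'I_n -> probability R R.
Variable A : streaming_alg R n.

Definition feedback (w : env n) (a : stream_action n) :
    probability R R :=
  if a is Pull i then if can_pull w i then nu i else \d_(0 : R) else \d_(0 : R).

(* [run T w s E] is the probability that the environment is in E after T steps
   of A from environment w and internal state s, when the i-th arriving arm has
   reward distribution [nu i]. Every pull draws a fresh reward, independently of
   the past. *)
Fixpoint run (T : nat) (w : env n) (s : alg_state A) (E : set (env n)) :
    \bar R :=
  if T is T'.+1 then
    (\int[feedback w (alg_action s)]_x \int[alg_next A (s, x)]_s'
       run T' (env_step w (alg_action s)) s' E)%E
  else (\1_E w)%:E.

End run.

Section run_lemmas.
Variables (R : realType) (n : nat).
Variable nu : 'I_n -> probability R R.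
Variable A : streaming_alg R n.

Lemma run_ge0 T w (s : alg_state A) E : (0 <= run nu T w s E)%E.
Proof.
elim: T w s => [|T IH] w s /=; first by rewrite lee_fin.
by apply: integral_ge0 => x _; exact: integral_ge0.
Qed.

(* In particular the integrals in [run] are integrals of nonnegative measurable
   functions. *)
Lemma measurable_run T w E :
  measurable_fun setT (fun s : alg_state A => run nu T w s E).
Proof.
elim: T w => [|T IH] w; first exact: measurable_cst.
pose g a (s : alg_state A) := (\int[feedback nu w a]_x \int[alg_next A (s, x)]_s'
       run nu T (env_step w a) s' E)%E.
have mg a : measurable_fun setT (g a).
  have m2 : measurable_fun setT (fun p : alg_state A * R =>
      (\int[alg_next A p]_s' run nu T (env_step w a) s' E)%E).
    apply: (measurable_fun_integral_finite_kernel (fun q => run nu T (env_step w a) q.2 E)).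
      by move=> z; exact: run_ge0.
    exact: (measurableT_comp (IH _) measurable_snd).
  apply: (measurable_fun_fubini_tonelli_F (m2 := feedback nu w a)
    (fun p : alg_state A * R => \int[alg_next A p]_s' run nu T (env_step w a) s' E)%E) => //.
  by move=> p; apply: integral_ge0 => s' _; exact: run_ge0.
move=> _ U mU; rewrite setTI.
rewrite (_ : _ @^-1` U = \bigcup_(a in [set: stream_action n]) ((@alg_action _ _ A @^-1` [set a]) `&` (g a @^-1` U))).
  apply: fin_bigcup_measurable; first exact: finite_stream_action.
  move=> a _; apply: measurableI; first exact: measurable_alg_action.
  by rewrite -[X in measurable X]setTI; exact: mg.
apply/seteqP; split=> s /=.
  by move=> Us; exists (alg_action s).
by move=> [a _ /= [<-]].
Qed.

Lemma run_setT T w (s : alg_state A) : run nu T w s setT = 1%E.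
Proof.
elim: T w s => [|T IH] w s /=; first by rewrite indicT.
under eq_integral => x _.
  under eq_integral => s' _ do rewrite IH.
  rewrite integral_cst// mul1e prob_kernel.
  over.
by rewrite integral_cst// mul1e; exact: probability_setT.
Qed.

End run_lemmas.

Definition mean (R : realType) (P : probability R R) : R :=
  fine (\int[P]_x x%:E).

Definition eps_best (R : realType) (n : nat)
    (nu : 'I_n -> probability R R) (eps : R) (i : 'I_n) : Prop :=
  \big[Num.max/mean (nu i)]_(j < n) mean (nu j) - eps <= mean (nu i).

(* Main.v *)
(* Rewards are rounded to random bits with the same mean, so that an algorithm is
   a finite binary decision tree and its success probability a finite sum. Arms
   are compared in a tournament. A group of level l + 1 consists of
   tow (l + 1) = 2 ^ tow l groups of level l; their winners are pulled about
   4 ^ l (ln (1 / delta) + tow l) / eps ^ 2 times each, and only the best one so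
   far is kept, so one arm is stored per level and log* n levels suffice. Level
   l + 1 loses eps / 2 ^ (l + 1) on the mean of the best arm and errs with
   probability delta / 2 ^ (l + 1), since only the groups containing the best
   arm matter. The groups grow so fast that the numbers of pulls at the
   successive levels decrease geometrically. When delta tends to 1 the number of
   pulls must tend to 0: the tournament is then restricted to a random block of
   about 4 (1 - delta) n arms. *)

Require Import Defs.
From HB Require Import structures.
From mathcomp Require Import all_boot all_order all_algebra all_fingroup.
From mathcomp Require Import all_classical all_reals all_analysis.
From mathcomp Require Import measurable_realfun.
From mathcomp Require Import ring lra zify.

Set Implicit Arguments.
Unset Strict Implicit.
Unset Printing Implicit Defensive.
Import Order.TTheory GRing.Theory Num.Theory.
Import numFieldNormedType.Exports.
Local Open Scope classical_set_scope.
Local Open Scope ring_scope.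

(** * Decision trees as streaming algorithms *)

(* After the action a of [Node a p l r], the tree continues with l with
   probability p + reward, truncated to [0, 1], and else with r: p = 0 for a pull,
   while other actions (with reward 0) toss a coin of bias p. *)
Inductive prog (R : realType) (n : nat) : Type :=
| Leaf of option 'I_n
| Node of stream_action n & R & prog R n & prog R n.
Arguments Leaf {R n}.
Arguments Node {R n}.

HB.instance Definition _ (R : realType) (n : nat) :=
  gen_eqMixin (prog R n).
HB.instance Definition _ (R : realType) (n : nat) :=
  gen_choiceMixin (prog R n).
HB.instance Definition _ (R : realType) (n : nat) :=
  isPointed.Build (prog R n) (Leaf None).
HB.instance Definition _ (R : realType) (n : nat) :=
  @isMeasurable.Build default_measure_display (prog R n)
    discrete_measurable discrete_measurable0
    discrete_measurableC discrete_measurableU.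

Section tree_algorithm.
Variables (R : realType) (n : nat).
Implicit Types (s : prog R n) (w : env n) (x : R).

Definition prog_action s : stream_action n := match s with
  | Leaf (Some i) => Answer i | Leaf None => Next | Node a _ _ _ => a end.
Definition bias s : R := if s is Node _ p _ _ then p else 0.
Definition left s := if s is Node _ _ l _ then l else s.
Definition right s := if s is Node _ _ _ r then r else s.

Definition clip x : R := Num.max 0 (Num.min x 1).

Lemma clip_ge0 x : 0 <= clip x.
Proof. by rewrite /clip le_max lexx. Qed.

Lemma clip_le1 x : clip x <= 1.
Proof. by rewrite /clip ge_max ler01 ge_min lexx orbT. Qed.

Lemma onem_clip_ge0 x : 0 <= 1 - clip x.
Proof. by rewrite subr_ge0 clip_le1. Qed.

Lemma clip_id x : 0 <= x <= 1 -> clip x = x.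
Proof. by move=> /andP[x0 x1]; rewrite /clip min_l // max_r. Qed.

Lemma measurable_clip : measurable_fun [set: R] clip.
Proof.
by apply: measurable_maxr => //; apply: measurable_minr.
Qed.

Lemma measurable_from_prog d (Y : measurableType d) (f : prog R n -> Y) :
  measurable_fun [set: prog R n] f.
Proof. by []. Qed.

Definition coin (y : prog R n * R) : R := clip (bias y.1 + y.2).

Lemma measurable_coin : measurable_fun [set: prog R n * R] coin.
Proof.
apply: (measurableT_comp measurable_clip).
apply: measurable_funD => //; exact: (measurableT_comp (measurable_from_prog _)).
Qed.

Definition step (y : prog R n * R) : {measure set prog R n -> \bar R} :=
  measure_add (mscale (NngNum (clip_ge0 (bias y.1 + y.2))) (\d_(left y.1)))
    (mscale (NngNum (onem_clip_ge0 (bias y.1 + y.2))) (\d_(right y.1))).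

Lemma stepE y U : step y U =
  ((coin y)%:E * \d_(left y.1) U + (1 - coin y)%:E * \d_(right y.1) U)%E.
Proof. exact: measure_addE. Qed.

Lemma measurable_step U : measurable U ->
  measurable_fun [set: prog R n * R] (step ^~ U).
Proof.
move=> mU; under eq_fun do rewrite stepE.
have mc := measurable_coin.
apply: emeasurable_funD; apply: emeasurable_funM; try exact/measurable_EFinP.
- exact: (measurableT_comp (measurable_from_prog (fun s => \d_(left s) U))).
- by apply/measurable_EFinP; apply: measurable_funB.
- exact: (measurableT_comp (measurable_from_prog (fun s => \d_(right s) U))).
Qed.

HB.instance Definition _ := isKernel.Build _ _ _ _ _ step measurable_step.

Lemma step_setT y : step y setT = 1%E.
Proof. by rewrite stepE !diracT !mule1 -EFinD subrKC. Qed.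

HB.instance Definition _ := Kernel_isProbability.Build _ _ _ _ _ step step_setT.

Lemma measurable_prog_action a : measurable (prog_action @^-1` [set a]).
Proof. by []. Qed.

Definition tree_alg (s : prog R n) : streaming_alg R n :=
  StreamingAlg s measurable_prog_action step.

Lemma integral_step (f : prog R n -> \bar R) y : (forall s, 0 <= f s)%E ->
  (\int[step y]_s f s =
   (coin y)%:E * f (left y.1) + (1 - coin y)%:E * f (right y.1))%E.
Proof.
move=> f0; rewrite /step ge0_integral_measure_add //.
by rewrite !ge0_integral_mscale // !integral_dirac //= !diracT !mul1e.
Qed.

End tree_algorithm.

(** * Success probabilities as finite sums over trees *)

Section tree_value.
Variables (R : realType) (n : nat) (nu : 'I_n -> probability R R).
Implicit Types (s : prog R n) (w : env n) (E : set (env n)).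

Definition chance w (a : stream_action n) (p : R) : R :=
  fine (\int[feedback nu w a]_x (clip (p + x))%:E).

Lemma measurable_clipD (p : R) : measurable_fun setT (fun x => clip (p + x)).
Proof.
exact: measurableT_comp (@measurable_clip R)
  (measurable_funD (measurable_cst p) (@measurable_id _ _ _)).
Qed.

Lemma measurable_mix (p : R) (u v : \bar R) : measurable_fun setT
  (fun x : R => ((clip (p + x))%:E * u + (1 - clip (p + x))%:E * v)%E).
Proof.
have mc := measurable_clipD p.
apply: emeasurable_funD; apply: emeasurable_funM => //.
  exact/measurable_EFinP.
by apply/measurable_EFinP; apply: measurable_funB.
Qed.

Lemma integral_le_mix (P : probability R R) (p : R) (u v u' v' : \bar R) :
  (0 <= u -> 0 <= v -> u <= u' -> v <= v' ->
   \int[P]_x ((clip (p + x))%:E * u + (1 - clip (p + x))%:E * v) <=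
   \int[P]_x ((clip (p + x))%:E * u' + (1 - clip (p + x))%:E * v'))%E.
Proof.
move=> u0 v0 uu vv.
have c0 x : (0 <= (clip (p + x))%:E)%E by rewrite lee_fin clip_ge0.
have c1 x : (0 <= (1 - clip (p + x))%:E)%E by rewrite lee_fin onem_clip_ge0.
apply: ge0_le_integral => //=; do ?exact: measurable_mix.
  by move=> x _; rewrite adde_ge0 // mule_ge0.
by move=> x _; rewrite leeD // lee_wpmul2l.
Qed.

Lemma integral_clip (P : probability R R) (p : R) :
  (0 <= \int[P]_x (clip (p + x))%:E <= 1)%E.
Proof.
apply/andP; split; first by apply: integral_ge0 => x _; rewrite lee_fin clip_ge0.
rewrite -(@probability_setT _ _ _ P) -[X in (_ <= X)%E]mul1e.
rewrite -(@integral_cst _ _ _ P setT) //; apply: ge0_le_integral => //=.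
- by move=> x _; rewrite lee_fin clip_ge0.
- by apply/measurable_EFinP; exact: measurable_clipD.
- by move=> x _; rewrite lee_fin clip_le1.
Qed.

Lemma chanceE w a p :
  (\int[feedback nu w a]_x (clip (p + x))%:E = (chance w a p)%:E)%E.
Proof.
rewrite /chance fineK //.
have /andP[i0 i1] := integral_clip (feedback nu w a) p.
by rewrite ge0_fin_numE //; apply: le_lt_trans i1 _; rewrite ltry.
Qed.

Lemma chance_itv w a p : 0 <= chance w a p <= 1.
Proof. by rewrite -2!lee_fin -chanceE integral_clip. Qed.

(* Only answering leaves are credited, so that [tree_val] bounds from below the
   probability of ending up in [E]. *)
Fixpoint tree_val w s E : R := match s with
  | Leaf None => 0
  | Leaf (Some i) => \1_E (env_step w (Answer i))
  | Node a p l r =>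
      let w' := env_step w a in
      chance w a p * tree_val w' l E + (1 - chance w a p) * tree_val w' r E
  end.

Lemma tree_val_itv w s E : 0 <= tree_val w s E <= 1.
Proof.
elim: s w => [[i|]|a p l IHl r IHr] w /=; rewrite ?lexx ?ler01 //.
  by rewrite indicE ler0n lern1 leq_b1.
have /andP[c0 c1] := chance_itv w a p.
have /andP[l0 l1] := IHl (env_step w a).
have /andP[r0 r1] := IHr (env_step w a).
by apply/andP; split; nra.
Qed.


Fixpoint depth s : nat :=
  if s is Node _ _ l r then (maxn (depth l) (depth r)).+1 else 0.

Lemma integral_mix (P : probability R R) (p a b : R) : 0 <= a -> 0 <= b ->
  (\int[P]_x ((clip (p + x))%:E * a%:E + (1 - clip (p + x))%:E * b%:E) =
   (\int[P]_x (clip (p + x))%:E) * a%:E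
    + (1 - \int[P]_x (clip (p + x))%:E) * b%:E)%E.
Proof.
move=> a0 b0; have mc := measurable_clipD p.
have mc1 : measurable_fun setT (fun x => (1 - clip (p + x))%:E).
  by apply/measurable_EFinP; apply: measurable_funB.
have mc2 : measurable_fun setT (fun x => (clip (p + x))%:E).
  exact/measurable_EFinP.
have c0 x : (0 <= (clip (p + x))%:E)%E by rewrite lee_fin clip_ge0.
have c1 x : (0 <= (1 - clip (p + x))%:E)%E by rewrite lee_fin onem_clip_ge0.
rewrite ge0_integralD //=; last 4 first.
- by move=> x _; rewrite mule_ge0.
- exact: emeasurable_funM.
- by move=> x _; rewrite mule_ge0.
- exact: emeasurable_funM.
rewrite !ge0_integralZr //.
congr (_ + _ * _)%E; under eq_integral do rewrite EFinB.
rewrite integralB ?integral_cst //=; last 2 first.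
- exact: finite_measure_integrable_cst.
- apply/integrableP; split => //; under eq_integral do rewrite gee0_abs //.
  by have /andP[_ /le_lt_trans] := integral_clip P p; apply; rewrite ltry.
by rewrite mul1e probability_setT.
Qed.

Lemma integral_mix_cst (P : probability R R) (p a : R) :
  (\int[P]_x ((clip (p + x))%:E * a%:E + (1 - clip (p + x))%:E * a%:E)
   = a%:E)%E.
Proof.
under eq_integral do rewrite -!EFinM -EFinD -mulrDl subrKC mul1r.
by rewrite integral_cst //= probability_setT mule1.
Qed.

Lemma run_step s0 T w s E :
  (run nu (A := tree_alg s0) T.+1 w s E =
   \int[feedback nu w (prog_action s)]_x
     ((clip (bias s + x))%:E *
        run nu (A := tree_alg s0) T (env_step w (prog_action s)) (left s) E
    + (1 - clip (bias s + x))%:E *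
        run nu (A := tree_alg s0) T (env_step w (prog_action s)) (right s) E))%E.
Proof.
rewrite /=; apply: eq_integral => x _.
by apply: (@integral_step _ _ _ (s, x)) => s'; exact: run_ge0.
Qed.

Lemma run_stay s0 T w (i : 'I_n) E : env_step w (Answer i) = w ->
  run nu (A := tree_alg s0) T w (Leaf (Some i)) E = (\1_E w)%:E.
Proof.
move=> wi; elim: T => // T IH; rewrite run_step /= wi IH.
exact: integral_mix_cst.
Qed.

(** At a node, linearity of the integral in the truncated reward turns one step of the run into the
    weighted sum of the two branches. The strict inequality leaves one step to carry out the answer
    at a leaf; afterwards the environment is frozen. *)
Lemma tree_val_le_run s0 T w s E : (depth s < T)%N ->
  ((tree_val w s E)%:E <= run nu (A := tree_alg s0) T w s E)%E.
Proof.
elim: T w s => // T IH w [[i|]|a p l r]; first 2 last.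
- rewrite [depth _]/= ltnS gtn_max => /andP[Hl Hr].
  have /andP[l0 _] := tree_val_itv (env_step w a) l E.
  have /andP[r0 _] := tree_val_itv (env_step w a) r E.
  rewrite run_step [tree_val _ _ _]/= EFinD !EFinM EFinB -chanceE.
  rewrite -integral_mix //.
  by apply: integral_le_mix; rewrite ?lee_fin ?IH.
- move=> _; rewrite run_step /= run_stay ?integral_mix_cst //.
  case: w => t M pk q [?|] //=.
  by case h: ((t == n) && (i \in M)) => /=; rewrite ?h.
- by move=> _; exact: run_ge0.
Qed.

Lemma run_le1 s0 T w s E : (run nu (A := tree_alg s0) T w s E <= 1)%E.
Proof.
rewrite -(run_setT nu (A := tree_alg s0) T w s).
elim: T w s => [|T IH] w s.
  by rewrite /= lee_fin !indicE in_setT lern1 leq_b1.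
rewrite !run_step.
by apply: integral_le_mix; rewrite ?run_ge0 ?IH.
Qed.

End tree_value.

Section chance_lemmas.
Variables (R : realType) (n : nat) (nu : 'I_n -> probability R R).
Hypothesis nu01 : forall i, nu i [set` `[0%R, 1%R]] = 1%E.
Implicit Types (w : env n).

(** Rewards lie in [0, 1] almost surely, so truncation changes nothing and the random bit has the
    mean of the arm. *)
Lemma chance_pull w i : can_pull w i -> chance nu w (Pull i) 0 = mean (nu i).
Proof.
move=> wi; rewrite /chance /= wi /mean; congr fine.
apply: ae_eq_integral => //.
- apply/measurable_EFinP; exact: measurable_clipD.
- exists (~` [set` `[0%R, 1%R]]); split.
  + exact: measurableC.
  + have := @probability_setC _ _ _ (nu i) [set` `[0%R, 1%R]] (measurable_itv _).
    by rewrite nu01 subee // => ->.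
  + move=> x /= Hx x01; apply: Hx => _.
    by rewrite add0r clip_id.
Qed.

Lemma mean_itv i : 0 <= mean (nu i) <= 1.
Proof.
(* Any environment that stores arm [i] makes its mean the chance of a coin. *)
pose w : env n := Env 0 [set i]%SET 0 0 None.
by rewrite -(@chance_pull w) ?chance_itv // /can_pull /= finset.inE eqxx.
Qed.

Lemma chance_no_pull w a p : (forall i, a <> Pull i) -> 0 <= p <= 1 ->
  chance nu w a p = p.
Proof.
move=> ha p01; rewrite /chance /feedback.
case: a ha => [i /(_ i)//||||]; move=> *;
  by rewrite integral_dirac ?diracT ?mul1e /= ?addr0 ?clip_id //;
    apply/measurable_EFinP; exact: measurable_clipD.
Qed.

End chance_lemmas.

(** * Concentration of binomial variables *)

Section binomial_expectation.
Variable R : realType.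
Implicit Types (s : nat) (mu x : R) (f g : nat -> R).

(* [Ebin s mu f] is the expectation of f at a binomial variable. *)
Fixpoint Ebin s mu f : R := if s is s'.+1 then
  mu * Ebin s' mu (f \o S) + (1 - mu) * Ebin s' mu f else f 0.

Lemma le_Ebin s mu f g : 0 <= mu <= 1 -> (forall b, f b <= g b) ->
  Ebin s mu f <= Ebin s mu g.
Proof.
move=> /andP[mu0 mu1]; elim: s f g => [|s IH] f g fg //=.
apply: lerD; apply: ler_wpM2l; rewrite ?subr_ge0 //.
  by apply: IH => b; apply: fg.
exact: IH.
Qed.

Lemma Ebin_linear s mu (a c x : R) f g :
  Ebin s mu (fun b => x + (a * f b + c * g b)) =
  x + (a * Ebin s mu f + c * Ebin s mu g).
Proof.
elim: s f g => [|s IH] f g //=.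
by rewrite (IH (f \o S) (g \o S)) IH; ring.
Qed.

Lemma Ebin_expR s mu (a c : R) :
  Ebin s mu (fun b => expR (a + c * b%:R)) =
  expR a * (mu * expR c + (1 - mu)) ^+ s.
Proof.
elim: s a => [|s IH] a /=; first by rewrite mulr0 addr0 expr0 mulr1.
rewrite IH (_ : _ \o S = fun b => expR ((a + c) + c * b%:R)); last first.
  by apply/funext => b /=; congr expR; rewrite -natr1; ring.
by rewrite IH expRD exprS; ring.
Qed.

(** From 1 - x <= exp (- x) follows exp x * (1 - x) <= 1, while (1 - x) * (1 + x + 2 * x ^ 2) = 1 +
    x ^ 2 * (1 - 2 * x) is at least 1. *)
Lemma expR_le_quadratic x : `|x| <= 1 / 2 -> expR x <= 1 + x + 2 * x ^+ 2.
Proof.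
move=> hx; have [x1 x2] : - (1 / 2) <= x /\ x <= 1 / 2.
  by apply/andP; rewrite -ler_norml.
have h := expR_ge1Dx (- x).
have e0 := expR_gt0 x.
have : expR x * (1 - x) <= 1.
  by rewrite -[leRHS](expRxMexpNx_1 x); apply: ler_wpM2l => //; exact: ltW.
move=> h2.
have h3 : (1 - x) * expR x <= (1 - x) * (1 + x + 2 * x ^+ 2).
  by apply: (le_trans (y := 1)); [rewrite mulrC | nra].
by rewrite ler_pM2l in h3; lra.
Qed.

(* Chernoff's method with exponent [d / 4] for the upper tail and [- (d / 4)] for
   the lower one. *)
Lemma Ebin_expR_le s mu (c d : R) : 0 <= mu <= 1 -> 0 < d <= 1 ->
  c = d / 4 \/ c = - (d / 4) ->
  Ebin s mu (fun b => expR (- (c * (s%:R * mu) + d / 4 * (s%:R * d)) + c * b%:R))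
    <= expR (- (s%:R * (d ^+ 2 / 8))).
Proof.
move=> /andP[mu0 mu1] /andP[d0 d1] hc; rewrite Ebin_expR.
have hc2 : c ^+ 2 = d ^+ 2 / 16 by case: hc => ->; field.
have cb : `|c| <= 1 / 2.
  by rewrite ler_norml; case: hc => ->; apply/andP; split; lra.
have h : mu * expR c + (1 - mu) <= expR (mu * c + d ^+ 2 / 8).
  apply: le_trans (expR_ge1Dx _).
  have := ler_wpM2l mu0 (expR_le_quadratic cb); rewrite hc2.
  have : 0 <= d ^+ 2 by rewrite sqr_ge0.
  nra.
have h0 : 0 <= mu * expR c + (1 - mu).
  by rewrite addr_ge0 ?subr_ge0 // mulr_ge0 // ltW ?expR_gt0.
have := lerXn2r s h0 (ltW (expR_gt0 _)) h.
rewrite -expRM_natl => /(ler_wpM2l (ltW (expR_gt0 _))).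
move=> /(_ (- (c * (s%:R * mu) + d / 4 * (s%:R * d)))) /le_trans; apply.
by rewrite -expRD ler_expR; lra.
Qed.

Definition accurate s mu (d : R) b : bool := `|b%:R - s%:R * mu| <= s%:R * d.

(** [f] will be the value of the rest of a program as a function of the count. It dominates [v]
    minus two exponentials, which are positive and one of which is at least 1 at any inaccurate
    count; Chernoff's method bounds their expectations. *)
Lemma Ebin_accurate s mu (d : R) (f : nat -> R) v : 0 <= mu <= 1 -> 0 < d <= 1 ->
  v <= 1 -> (forall b, 0 <= f b) ->
  (forall b, accurate s mu d b -> v <= f b) ->
  v - 2 * expR (- (s%:R * (d ^+ 2 / 8))) <= Ebin s mu f.
Proof.
move=> mu01 d01 v1 f0 hf.
pose e c b : R := expR (- (c * (s%:R * mu) + d / 4 * (s%:R * d)) + c * b%:R).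
have := @le_Ebin s mu
  (fun b => v + (- 1 * e (d / 4) b + - 1 * e (- (d / 4)) b)) f mu01.
rewrite Ebin_linear => H; apply: le_trans (H _).
  have := Ebin_expR_le s mu01 d01 (or_introl erefl).
  have := Ebin_expR_le s mu01 d01 (or_intror erefl).
  rewrite /e; lra.
move=> b; have e0 c : 0 < e c b by rewrite expR_gt0.
have := e0 (d / 4); have := e0 (- (d / 4)).
have [/hf|] := boolP (accurate s mu d b); first lra.
have /andP[d0 d1] := d01.
have e1 c : 0 <= - (c * (s%:R * mu) + d / 4 * (s%:R * d)) + c * b%:R ->
    1 <= e c b.
  by move=> h; rewrite /e -[leLHS](@expR0 R) ler_expR.
have := f0 b; rewrite /accurate -ltNge lter_normr => fb0 /orP[h|h].
  have := e1 (d / 4); nra.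
have := e1 (- (d / 4)); nra.
Qed.

End binomial_expectation.

(** * The tournament *)

Fixpoint tow (l : nat) : nat := if l is l'.+1 then (2 ^ tow l')%N else 1%N.

Fixpoint grp (l : nat) : nat := if l is l'.+1 then (grp l' * tow l)%N else 1%N.

Lemma tow_gt0 l : (0 < tow l)%N.
Proof. by case: l => // l; rewrite /= expn_gt0. Qed.

Lemma grp_gt0 l : (0 < grp l)%N.
Proof. by elim: l => // l IH; rewrite /= muln_gt0 IH expn_gt0. Qed.

Section programs.
Variables (R : realType) (n : nat).
Local Notation prog := (prog R n.+1).
Local Notation arm := ('I_n.+1).

Definition perform (a : stream_action n.+1) (k : prog) : prog := Node a 0 k k.

(** Continuation-passing style: [k] is the rest of the tree and receives the number of bits equal to
    1, so counters need no explicit state. *)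
Fixpoint sample (i : arm) (s : nat) (k : nat -> prog) : prog :=
  if s is s'.+1 then Node (Pull i) 0 (sample i s' (k \o S)) (sample i s' k)
  else k 0.

Definition winner (c : option (arm * nat)) (x : arm * nat) : arm * nat :=
  if c is Some y then if (y.2 < x.2)%N then x else y else x.

Definition duel (c : option (arm * nat)) (x : arm * nat)
    (k : arm * nat -> prog) : prog :=
  if c is Some y then
    perform (Discard (if (y.2 < x.2)%N then y.1 else x.1)) (k (winner c x))
  else k x.

(* Only the K arms arriving from time o on take part; [u] counts from o. *)
Variables (o K : nat).

(** The recursion is on the number of rounds left; the test on [u] ends the level early when the
    block is exhausted, so [K] need not be a multiple of [N]. *)
Definition play (sub : nat -> (arm -> prog) -> prog) (N s : nat) :=
  fix rounds (m u : nat) (c : option (arm * nat)) (k : arm -> prog) : prog :=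
  let stop := if c is Some x then k x.1 else Leaf None in
  if m is m'.+1 then
    if (u < K)%N then
      sub u (fun a => sample a s (fun b =>
        duel c (a, b) (fun c' => rounds m' (u + N)%N (Some c') k)))
    else stop
  else stop.

Variable s : nat -> nat.

Fixpoint tournament (l u : nat) (k : arm -> prog) : prog :=
  if l is l'.+1 then play (tournament l') (grp l') (s l') (tow l) u None k
  else perform Store (perform Next (k (inord (o + u)%N))).

(* [rivals N u] groups of size N start before u; hence [cost l u] pulls are made
   at levels up to l before u. *)
Definition rivals (N u : nat) : nat := ((minn K u + N.-1) %/ N)%N.

Definition cost (l u : nat) : nat := (\sum_(j < l) s j * rivals (grp j) u)%N.

Lemma rivalsD (N u : nat) : (0 < N)%N -> (N %| u)%N -> (u < K)%N ->
  rivals N (u + N) = (rivals N u).+1.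
Proof.
move=> N0 /dvdnP[a ->] aK; rewrite /rivals (minn_idPr (ltnW aK)).
have [r rN er] : exists2 r, (r < N)%N & minn K (a * N + N) = (a * N + r.+1)%N.
  by exists (minn K (a * N + N) - a * N).-1; lia.
rewrite er -addnA addSnnS prednK // !divnMDl // divnDr ?dvdnn // divnn N0.
by rewrite !divn_small ?add0n ?addn0 ?addn1 // prednK.
Qed.

End programs.

(** * Values of tournament programs and the rule for one level *)

Section tournament_value.
Variables (R : realType) (n : nat) (nu : 'I_n.+1 -> probability R R).
Hypothesis nu01 : forall i, nu i [set` `[0%R, 1%R]] = 1%E.
Variable E : set (env n.+1).
Local Notation arm := ('I_n.+1).
Local Notation V := (fun w s => tree_val nu w s E).
Local Notation state t M pk q := (@Env n.+1 t M pk q None).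

Lemma val_perform w a k : V w (perform a k) = V (env_step w a) k.
Proof. by rewrite /=; ring. Qed.

Lemma val_sample t (M : {set arm}) pk q i s k : i \in M ->
  V (state t M pk q) (sample i s k) =
  Ebin s (mean (nu i)) (fun b => V (state t M pk (q + s)%N) (k b)).
Proof.
move=> iM; elim: s q k => [|s IH] q k; first by rewrite /= addn0.
have hp : can_pull (state t M pk q) i by rewrite /can_pull /= iM.
have st : env_step (state t M pk q) (Pull i) = state t M pk q.+1.
  by move: hp => /= ->.
set w := state t M pk q.
transitivity (let c := chance nu w (Pull i) 0 in
  c * V (env_step w (Pull i)) (sample i s (k \o S)) +
  (1 - c) * V (env_step w (Pull i)) (sample i s k)); first by [].
by rewrite st (chance_pull nu01 hp) !IH addSnnS.
Qed.

Variables (o K : nat).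
Hypothesis oK : (o + K <= n.+1)%N.

(** Stream position at tournament time [u], which overshoots the block when the last group is
    incomplete. *)
Definition clock (u : nat) : nat := (o + minn K u)%N.

Definition before (t : nat) (M : {set arm}) := forall x, x \in M -> (x < t)%N.

(* [finds h po N sub u G x]: from time u on, [sub u] processes a group of N arms
   in h extra memory cells and, but for probability x, proceeds with an arm
   of the group in G; the numbers of pulls are the increments of po. *)
Definition finds (h : nat) (po : nat -> nat) (N : nat)
    (sub : nat -> (arm -> prog R n.+1) -> prog R n.+1) (u : nat)
    (G : arm -> Prop) (x : R) : Prop :=
  forall M pk q B k v,
    before (clock u) M -> (pk <= B)%N -> (#|M| + h <= B)%N -> v <= 1 ->
    (forall a pk' q', a \notin M -> (a < clock (u + N))%N -> (pk' <= B)%N ->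
       (q' + po u = q + po (u + N))%N -> G a ->
       v <= V (state (clock (u + N)) (a |: M)%SET pk' q') (k a)) ->
  v - x <= V (state (clock u) M pk q) (sub u k).

Lemma tournament0_finds s u : (u < K)%N ->
  finds 1 (cost K s 0) 1 (tournament o K s 0) u (eq (inord (o + u)%N)) 0.
Proof.
move=> uK M pk q B k v bM pkB MB v1 H; rewrite subr0 [tournament _ _ _ _]/=.
have on : (o + u < n.+1)%N by lia.
have cu : clock u = (o + u)%N by rewrite /clock; lia.
have cu1 : clock (u + 1) = (o + u).+1 by rewrite /clock; lia.
rewrite !val_perform cu [env_step _ Store]/= insubT /=.
set i := Sub _ _.
have -> : inord (o + u)%N = i by apply: val_inj; rewrite /= inordK.
rewrite on -cu1; apply: H => //.
- by apply/negP => /bM; rewrite cu /= ltnn.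
- by rewrite cu1 /= ltnS.
- by rewrite geq_max pkB (leq_trans _ MB) // cardsU1 addnC leq_add2l leq_b1.
- by rewrite /cost !big_ord0.
- by apply: val_inj; rewrite /= inordK.
Qed.

Section play.
Variables (h : nat) (po : nat -> nat) (N s : nat).
Variables (sub : nat -> (arm -> prog R n.+1) -> prog R n.+1).
Hypothesis N0 : (0 < N)%N.
Hypothesis po_min : forall u, po u = po (minn K u).
Variables (acc : arm -> nat -> Prop) (y : R).
Hypothesis y0 : 0 <= y.
Hypothesis accP : forall a (f : nat -> R) v, v <= 1 -> (forall b, 0 <= f b) ->
  (forall b, acc a b -> v <= f b) -> v - y <= Ebin s (mean (nu a)) f.
Variable I : nat -> nat -> option (arm * nat) -> Prop.
Variable D : nat -> nat -> R.
Hypothesis D0 : forall m u, 0 <= D m u.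
Variable good : arm -> Prop.
Hypothesis Istep : forall m u c, I m.+1 u c -> (u < K)%N -> (N %| u)%N ->
  exists G x, [/\ finds h po N sub u G x,
    forall a b, G a -> acc a b -> I m (u + N)%N (Some (winner c (a, b))) &
    x + y + D m (u + N)%N <= D m.+1 u].
Hypothesis Istop : forall m u c, I m u c -> m = 0%N \/ (K <= u)%N ->
  exists2 x, c = Some x & good x.1.

Definition add_champion (c : option (arm * nat)) (M : {set arm}) :=
  if c is Some x then (x.1 |: M)%SET else M.

Lemma clockD u v : (K <= u)%N -> clock (u + v) = clock u.
Proof. by rewrite /clock; lia. Qed.

(** The challenger, the champion and the arms of [M] are distinct, so discarding the loser removes
    nothing else. *)
Lemma val_duel t (M : {set arm}) pk q a b c k : a \notin add_champion c M ->
  (forall x, c = Some x -> x.1 \notin M) ->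
  V (state t (a |: add_champion c M)%SET pk q) (duel c (a, b) k) =
  V (state t (add_champion (Some (winner c (a, b))) M) pk q)
    (k (winner c (a, b))).
Proof.
case: c => [x|] // aM /(_ _ erefl) xM; rewrite [duel _ _ _]/duel.
have /norP[ax aM'] : ~~ ((a == x.1) || (a \in M)) by rewrite -finset.in_setU1.
rewrite val_perform [env_step _ _]/=; congr (tree_val _ _ _ _); congr Env.
rewrite /winner /=; case: ifP => _ /=.
  rewrite finset.setUCA setU1K // finset.in_setU1 (negbTE xM) orbF.
  by rewrite eq_sym.
by rewrite setU1K // finset.in_setU1 (negbTE ax).
Qed.

(** Loop rule by induction on the rounds left: [I] is an invariant on rounds left, time and
    champion, and [D] bounds the risk still to come. The champion takes one cell beyond the [h] used
    by [sub]. *)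
Lemma play_value m u c M pk q B k v :
  I m u c -> (N %| u)%N -> before (clock u) (add_champion c M) ->
  (forall x, c = Some x -> x.1 \notin M) ->
  (pk <= B)%N -> (#|M| + h.+1 <= B)%N -> v <= 1 ->
  let po' t := (po t + s * rivals K N t)%N in
  (forall a pk' q', a \notin M -> (a < clock (u + m * N))%N -> (pk' <= B)%N ->
     (q' + po' u = q + po' (u + m * N))%N -> good a ->
     v <= V (state (clock (u + m * N)) (a |: M)%SET pk' q') (k a)) ->
  v - D m u <= V (state (clock u) (add_champion c M) pk q)
                 (play K sub N s m u c k).
Proof.
move=> + + + + + MB v1 po'.
(* Both exits of the loop at once. Past the block, clock and pull count no longer move, so the
   rounds left are free. *)
have stop m' u' c' pk' q' : I m' u' c' -> m' = 0%N \/ (K <= u')%N ->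
    before (clock u') (add_champion c' M) ->
    (forall x, c' = Some x -> x.1 \notin M) -> (pk' <= B)%N ->
    (forall a pk'' q'', a \notin M -> (a < clock (u' + m' * N))%N ->
       (pk'' <= B)%N -> (q'' + po' u' = q' + po' (u' + m' * N))%N -> good a ->
       v <= V (state (clock (u' + m' * N)) (a |: M)%SET pk'' q'') (k a)) ->
    v - D m' u' <= V (state (clock u') (add_champion c' M) pk' q')
                     (if c' is Some x then k x.1 else Leaf None).
  move=> Ic hm + + pkB; have [x -> gx] := Istop Ic hm => bM cM H.
  have hc : clock (u' + m' * N) = clock u'.
    by case: hm => [->|Ku]; [rewrite mul0n addn0|rewrite clockD].
  have hp : po' (u' + m' * N)%N = po' u'.
    case: hm => [->|Ku]; first by rewrite mul0n addn0.
    rewrite /po' /rivals po_min [in RHS]po_min.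
    by rewrite (minn_idPl Ku) (minn_idPl (leq_trans Ku (leq_addr _ _))).
  apply: (@le_trans _ _ v); first by rewrite gerBl.
  move: H; rewrite hc => /(_ x.1 pk' q'); apply => //; last by rewrite hp.
  + exact: cM.
  + by apply: bM; rewrite finset.in_setU1 eqxx.
elim: m u c pk q => [|m IH] u c pk q Ic Nu bM cM pkB H.
  by apply: stop Ic _ bM cM pkB H; left.
rewrite [play _ _ _ _ _ _ _ _]/=; case: ifPn => uK; last first.
  by apply: stop Ic _ bM cM pkB H; right; rewrite leqNgt.
have [G [x [fG GI Dx]]] := Istep Ic uK Nu.
(* The round spends [x] on the group and [y] on the samples, and keeps [D] for later rounds. *)
apply: le_trans (_ : v - y - D m (u + N)%N - x <= _); first by move: Dx; lra.
apply: (fG _ _ _ B) => //.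
- case: c {Ic GI H} bM cM => [z|] bM cM; last first.
    by apply: leq_trans MB; rewrite leq_add2l.
  apply: leq_trans MB; rewrite /= cardsU1 addnS -addSn leq_add2r.
  by rewrite -[#|M|.+1]add1n leq_add2r leq_b1.
- by apply: le_trans v1; rewrite -addrA -opprD gerBl addr_ge0.
move=> a pk' q' aM au pkB' hq Ga.
rewrite val_sample ?finset.in_setU1 ?eqxx // addrAC.
apply: accP => [|b|b ab]; first by apply: le_trans v1; rewrite gerBl.
  by have /andP[] := tree_val_itv nu (state (clock (u + N))
    (a |: add_champion c M)%SET pk' (q' + s)%N)
    (duel c (a, b) (fun c' => play K sub N s m (u + N)%N (Some c') k)) E.
rewrite val_duel //.
have uNm : (u + N + m * N = u + m.+1 * N)%N by rewrite mulSn addnA.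
have cluN : (clock u <= clock (u + N))%N by rewrite /clock; lia.
apply: IH => //; first exact: GI; first exact: dvdn_add.
- move=> z; rewrite finset.in_setU1 => /orP[/eqP ->|zM].
    case: c bM {cM aM Ic GI} => [z'|] bM //=; case: ifP => _ //=.
    by apply: leq_trans cluN; apply: bM; rewrite finset.in_setU1 eqxx.
  apply: leq_trans cluN; apply: bM; case: c {cM aM Ic GI} => [z'|] //=.
  by rewrite finset.in_setU1 zM orbT.
- have aM' : a \notin M.
    case: c aM {bM cM Ic GI} => [z|] //=.
    by rewrite finset.in_setU1 => /norP[].
  move=> _ [<-]; case: c cM {bM Ic GI aM} => [z|] //= cM.
  by case: ifP => _ //=; exact: cM.
- move=> a0 pk0 q0; rewrite uNm => a1 a2 a3 a4 a5; apply: H => //.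
  by move: a4; rewrite /po' rivalsD // mulnS; lia.
Qed.

End play.
End tournament_value.

(** * Error and risk of the whole tournament *)

Section tournament_spec.
Variables (R : realType) (n : nat) (nu : 'I_n.+1 -> probability R R).
Hypothesis nu01 : forall i, nu i [set` `[0%R, 1%R]] = 1%E.
Variable E : set (env n.+1).
Variables (o K : nat).
Hypothesis oK : (o + K <= n.+1)%N.
Variable s : nat -> nat.
Local Notation arm := ('I_n.+1).
Local Notation found l u G x :=
  (finds nu E o K l.+1 (cost K s l) (grp l) (@tournament R n o K s l) u G x).

Lemma cost_min l u : cost K s l u = cost K s l (minn K u).
Proof. by apply: eq_bigr => j _; rewrite /rivals minnA minnn. Qed.

Lemma found_sub l u (G G' : arm -> Prop) (x : R) :
  (forall a, G a -> G' a) -> found l u G x -> found l u G' x.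
Proof.
move=> GG' H M pk q B k v bM pkB MB v1 Hk; apply: (H _ _ _ B) => //.
by move=> a pk' q' a1 a2 a3 a4 /GG'; exact: Hk.
Qed.

Lemma play_found l u (acc : arm -> nat -> Prop) (y : R)
    (I : nat -> nat -> option (arm * nat) -> Prop) (D : nat -> nat -> R)
    (good : arm -> Prop) :
  0 <= y ->
  (forall a (f : nat -> R) v, v <= 1 -> (forall b, 0 <= f b) ->
    (forall b, acc a b -> v <= f b) -> v - y <= Ebin (s l) (mean (nu a)) f) ->
  (forall m u, 0 <= D m u) ->
  (forall m u c, I m.+1 u c -> (u < K)%N -> (grp l %| u)%N ->
    exists G x, [/\ found l u G x,
      forall a b, G a -> acc a b -> I m (u + grp l)%N (Some (winner c (a, b))) &
      x + y + D m (u + grp l)%N <= D m.+1 u]) ->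
  (forall m u c, I m u c -> m = 0%N \/ (K <= u)%N ->
    exists2 x, c = Some x & good x.1) ->
  (grp l %| u)%N -> I (tow l.+1) u None ->
  found l.+1 u good (D (tow l.+1) u).
Proof.
move=> y0 accP D0 Istep Istop lu Iu M pk q B k v bM pkB MB v1 H.
have cE t : cost K s l.+1 t = (cost K s l t + s l * rivals K (grp l) t)%N.
  by rewrite /cost big_ord_recr.
have gE : grp l.+1 = (tow l.+1 * grp l)%N by rewrite mulnC.
apply: (play_value nu01 oK (grp_gt0 l) (@cost_min l) y0 accP D0 Istep Istop Iu
  lu (M := M) (B := B)) => //.
by rewrite -gE => a pk' q' a1 a2 a3 a4; apply: H => //; rewrite !cE.
Qed.

(** Whatever the rewards, there is a champion from the first round on. This lets groups without the
    best arm be played at no risk. *)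
Lemma tournament_finds l u : (u < K)%N -> (grp l %| u)%N ->
  found l u (fun=> True) 0.
Proof.
elim: l u => [|l IH] u uK lu.
  apply: (@found_sub _ _ (eq (inord (o + u)%N))) => //.
  exact: tournament0_finds.
apply: (@play_found l u (fun _ _ => True) 0
  (fun m u c => c = None -> (u < K)%N /\ (0 < m)%N) (fun _ _ => 0)) => //.
- move=> a f v v1 f0 H; rewrite subr0.
  rewrite -[leLHS](_ : Ebin (s l) (mean (nu a)) (fun=> v) = v).
    by apply: le_Ebin => [|b]; [exact: mean_itv|exact: H].
  by elim: (s l) => //= m ->; ring.
- move=> m v c _ vK lv; exists (fun=> True), 0.
  by split; [exact: IH|by []|rewrite !addr0].
- move=> m v [x|] /(_ _); first by exists x.
  by move=> /(_ erefl)[vK m0] []; lia.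
- by apply: dvdn_trans lu; rewrite [grp l.+1]/= dvdn_mulr.
- by rewrite tow_gt0.
Qed.

Variables (best : nat) (eps delta : R).
Hypothesis bK : (best < K)%N.
Hypothesis eps01 : 0 < eps < 1.
Hypothesis delta0 : 0 < delta.
Hypothesis s0 : forall l, (0 < s l)%N.

(** Empirical means accurate to [slack l] compare arms up to twice that, which is the loss eps / 2 ^
    (l + 1). *)
Definition slack (l : nat) : R := eps / 2 ^+ l.+2.

Hypothesis s_large : forall l,
  (tow l.+1)%:R * (2 * expR (- ((s l)%:R * (slack l ^+ 2 / 8))))
    <= delta / 2 ^+ l.+1.

Definition good_enough (l : nat) (a : arm) : Prop :=
  mean (nu (inord (o + best)%N)) - eps * (1 - 2 ^- l) <= mean (nu a).

Definition risk (l : nat) : R := delta * (1 - 2 ^- l).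

Lemma exp2S l : 2 ^- l = 2 * 2 ^- l.+1 :> R.
Proof. by rewrite exprS invfM mulrA divff ?mul1r // pnatr_eq0. Qed.

Lemma exp2_itv l : 0 < (2 ^- l : R) <= 1.
Proof. rewrite invr_gt0 exprn_gt0 //= invf_le1 ?exprn_gt0 //.
by rewrite exprn_ege1 // ler1n. Qed.

Lemma slack_itv l : 0 < slack l <= 1.
Proof.
have /andP[] := exp2_itv l.+2; move: eps01 => /andP[e0 e1].
by rewrite /slack => h1 h2; rewrite mulr_gt0 //=; nra.
Qed.

Lemma risk_ge0 l : 0 <= risk l.
Proof.
have /andP[_ h] := exp2_itv l.
by apply: mulr_ge0; [exact: ltW | rewrite subr_ge0].
Qed.

(** Induction on levels. The group of [best] sends up an arm of mean at least [th], whose count is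
    at least [sl * (th - d)]. Later champions have no smaller count, and a count of at most
    [sl * (mean + d)] forces a mean of at least [th - 2 * d]. *)
Lemma tournament_finds_good l u : (u <= best < u + grp l)%N -> (grp l %| u)%N ->
  found l u (good_enough l) (risk l).
Proof.
elim: l u => [|l IH] u /andP[ub bu] lu.
  have -> : risk 0 = 0 by rewrite /risk expr0 invr1 subrr mulr0.
  apply: (@found_sub _ _ (eq (inord (o + u)%N))); last first.
    by apply: tournament0_finds => //; exact: leq_ltn_trans bK.
  move=> _ <-.
  rewrite /good_enough expr0 invr1 subrr mulr0 subr0.
  by have -> : u = best by move: bu => /=; lia.
set d := slack l; have d01 : 0 < d <= 1 := slack_itv l.
set y := 2 * expR (- ((s l)%:R * (d ^+ 2 / 8))).
have y0 : 0 <= y by rewrite mulr_ge0 // ltW // expR_gt0.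
set sl : R := (s l)%:R; have sl0 : 0 < sl by rewrite ltr0n.
set th := mean (nu (inord (o + best)%N)) - eps * (1 - 2 ^- l).
have r0 := risk_ge0 l.
(* Every remaining round may bring an inaccurate sample; the risk of the lower levels is due only
   while the group of [best] is still to come. *)
pose D m u : R := m%:R * y + (if (u <= best)%N then risk l else 0).
(* [best] is past or within the remaining rounds. The champion's count is never too high for its
   mean and, once [best] is past, never below the threshold. *)
pose I m u (c : option (arm * nat)) := (best < u + m * grp l)%N /\
  if c is Some x then x.2%:R <= sl * (mean (nu x.1) + d) /\
                      ((best < u)%N -> sl * (th - d) <= x.2%:R)
  else (u <= best)%N.
suff : found l.+1 u (good_enough l.+1) (D (tow l.+1) u).
  move=> H M pk q B k v bM pkB MB v1 Hk.
  apply: le_trans (H M pk q B k v bM pkB MB v1 Hk); rewrite lerD2l lerN2.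
  rewrite /D ub /risk (exp2S l); have := s_large l.
  rewrite -/d -/y; lra.
apply: (@play_found l u (fun a b => accurate (s l) (mean (nu a)) d b) y I D) => //.
- move=> a f v v1 f0 H; apply: Ebin_accurate => //; exact: mean_itv.
- by move=> m v; rewrite addr_ge0 ?mulr_ge0 //; case: ifP.
- move=> m v c [bv Hc] vK lv.
  have acc_up a b : accurate (s l) (mean (nu a)) d b ->
      b%:R <= sl * (mean (nu a) + d) /\ sl * (mean (nu a) - d) <= b%:R.
    by rewrite /accurate -/sl ler_norml => /andP[h1 h2]; split; lra.
  have bv' : (best < v + grp l + m * grp l)%N by rewrite -addnA -mulSn.
  have [hb|hb] := boolP (v <= best < v + grp l)%N.
    exists (good_enough l), (risk l); split; first exact: IH.
      move=> a b Ga /acc_up[u1 u2]; split => //; move/andP: hb => [hb _].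
      have l1 : sl * (th - d) <= b%:R.
        by apply: le_trans u2; rewrite ler_pM2l // lerD2r.
      case: c Hc => [[a' b']|] /= Hc; last by split.
      case: ifP => /= hbb; split => //; first by case: Hc.
      by move=> _; apply: le_trans l1 _; rewrite ler_nat leqNgt hbb.
    have /andP[hb1 hb2] := hb.
    rewrite /D hb1 [(v + _ <= _)%N]leqNgt hb2 /= -natr1; lra.
  (* In the other groups any winner will do, provided that its count is not too high for its
     mean. *)
  exists (fun=> True), 0; split; first exact: tournament_finds.
    move=> a b _ /acc_up[u1 u2]; split => //.
    case: c Hc => [[a' b']|] /= Hc; last first.
      by split => // h; exfalso; move: hb; rewrite Hc h.
    case: Hc => h1 h2; case: ifP => /= hbb; split => //.
      move=> h; apply: le_trans (_ : b'%:R <= _); last by rewrite ler_nat ltnW.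
      by apply: h2; move: hb; rewrite h andbT -ltnNge.
    by move=> h; apply: h2; move: hb; rewrite h andbT -ltnNge.
  have -> : D m (v + grp l)%N = D m v.
    rewrite /D; congr (_ + _); have := grp_gt0 l.
    case: (leqP v best) hb => h1 /= h2 g0; last first.
      by rewrite leqNgt (leq_trans h1 (leq_addr _ _)).
    by rewrite leqNgt h2.
  rewrite /D -natr1; lra.
- move=> m v c [bv Hc] hm; have bv' : (best < v)%N.
    by case: hm => [m0|Kv]; [move: bv; rewrite m0 addn0|exact: leq_trans bK Kv].
  case: c Hc => [x|]; last by rewrite leqNgt bv'.
  move=> [h1 /(_ bv') h2]; exists x => //.
  have : sl * (th - d) <= sl * (mean (nu x.1) + d) := le_trans h2 h1.
  rewrite ler_pM2l // /good_enough /th (exp2S l) => h.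
  have -> : 2 ^- l.+1 = 2 * (2 ^- l.+2) :> R by exact: exp2S.
  move: h; rewrite (exp2S l.+1) /d /slack; lra.
- by apply: dvdn_trans lu; rewrite [grp l.+1]/= dvdn_mulr.
- by split => //; move: bu; rewrite mulnC.
Qed.

End tournament_spec.

(** * Number of levels and of pulls *)

Section growth.

Lemma ltn_tow l : (l < tow l)%N.
Proof. by elim: l => //= l IH; apply: leq_ltn_trans IH (ltn_expl _ _). Qed.

Lemma tow_le_grp l : (tow l <= grp l)%N.
Proof. by case: l => // l; rewrite [grp _]/= leq_pmull // grp_gt0. Qed.

(** As [grp l.+1] is [grp l * tow l.+1], it suffices that 8 ^ (l + 1) <= 64 * grp l; from level 3
    on, each new factor of [grp] is at least 8. Samples grow only like 4 ^ l * tow l, so a factor 2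
    ^ l is gained. *)
Lemma exp8_tow_le_grp l : (8 ^ l * tow l <= 64 * grp l)%N.
Proof.
case: l => // l; rewrite [grp _]/= mulnA leq_mul2r; apply/orP; right.
elim: l => [//|[//|[//|l]]] IH; rewrite expnS.
have e : grp l.+3 = (grp l.+2 * tow l.+3)%N by [].
apply: leq_trans (leq_mul (leqnn 8) IH) _.
rewrite e mulnCA leq_mul2l /= mulnC leq_mul2l; apply/orP; right.
apply: (@leq_trans (2 ^ 3)%N) => //; rewrite leq_exp2l //.
exact: leq_trans (ltn_tow l.+2).
Qed.

Lemma ex_grp_ge K : exists l, (K <= grp l)%N.
Proof. by exists K; apply: leq_trans (tow_le_grp K); exact: ltnW (ltn_tow K). Qed.

Definition height K : nat := ex_minn (ex_grp_ge K).

Lemma leq_grp_height K : (K <= grp (height K))%N.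
Proof. by rewrite /height; case: ex_minnP. Qed.

Lemma grp_lt K l : (l < height K)%N -> (grp l < K)%N.
Proof.
rewrite /height; case: ex_minnP => m _ mP lm; rewrite ltnNge.
by apply: contraTN lm => /mP; rewrite leqNgt.
Qed.

Variable R : realType.

Lemma ln2_gt0 : 0 < ln 2 :> R.
Proof. by rewrite ln_gt0 // ltr1n. Qed.

Lemma tow_lt_iter_log2 n l k : (tow l < n)%N -> (k <= l)%N ->
  (tow (l - k))%:R < iter k (@log2 R) n%:R.
Proof.
move=> ln; elim: k => [_|k IH kl]; first by rewrite subn0 ltr_nat.
have := IH (ltnW kl); rewrite -(subnSK kl) [tow _.+1]/= => h.
rewrite iterS /log2 ltr_pdivlMr ?ln2_gt0 // mulr_natl -lnXn //.
rewrite ltr_ln ?posrE ?exprn_gt0 //.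
  by rewrite -natrX.
by apply: le_lt_trans h; rewrite ler0n.
Qed.

(** If the height is l + 1, then tow l <= grp l < n. Each logarithm removes one storey of the tower,
    so after at most l of them the value still exceeds 1. *)
Lemma height_le_logstar K n : (K <= n)%N -> (height K <= logstar R n)%N.
Proof.
case E : (height K) => [|l] // Kn; rewrite ltnNge /logstar.
case: ex_minnP => m hm _; apply/negP => ml.
have ln : (tow l < n)%N.
  by apply: leq_ltn_trans (tow_le_grp l) (leq_trans _ Kn); rewrite grp_lt // E.
have := lt_le_trans (tow_lt_iter_log2 ln ml) hm.
by rewrite ltrn1 ltnNge tow_gt0.
Qed.

End growth.

Section sample_sizes.
Variables (R : realType) (eps delta : R).
Hypothesis eps01 : 0 < eps < 1.
Hypothesis delta_itv : 0 < delta <= 1 / 2.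

Definition sample_bound (l : nat) : R :=
  8 / slack eps l ^+ 2 * (ln (1 / delta) + 3 * (tow l)%:R).

Definition sample_size (l : nat) : nat := (Num.truncn (sample_bound l)).+1.

Lemma ln1_ge (x : R) : 0 < x -> 1 - x <= ln (1 / x).
Proof.
move=> x0; rewrite div1r lnV ?posrE //.
have := ln_sublinear x0; have := @le_ln1Dx R (x - 1); rewrite subrKC => h _.
by have := h _; lra.
Qed.

Lemma lnV_delta_ge : 1 / 2 <= ln (1 / delta).
Proof.
by have /andP[d0 d1] := delta_itv; have := ln1_ge d0; lra.
Qed.

Lemma sample_bound_ge0 l : 0 <= sample_bound l.
Proof.
have := lnV_delta_ge; have : 0 <= (tow l)%:R :> R by rewrite ler0n.
by move=> h1 h2; apply: mulr_ge0; [rewrite divr_ge0 // sqr_ge0 | lra].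
Qed.

Lemma sample_size_ge l : sample_bound l <= (sample_size l)%:R.
Proof. by rewrite ltW // truncnS_gt. Qed.

Lemma sample_size_le l : (sample_size l)%:R <= sample_bound l + 1.
Proof. by rewrite -natr1 lerD2r truncn_le // sample_bound_ge0. Qed.

Lemma expRN_le_exp2 (m : nat) : expR (- m%:R) <= 2 ^- m :> R.
Proof.
rewrite expRN lef_pV2 ?posrE ?exprn_gt0 ?expR_gt0 //.
rewrite -[m%:R]mulr1 expRM_natl lerXn2r // ?nnegrE ?expR_ge0 //.
by have := expR_ge1Dx (1 : R).
Qed.

(** The size inverts the Chernoff exponent and makes the exponential at most delta * 2 ^ - (3 * tow
    l). The union over 2 ^ tow l rounds and two tails leaves delta * 2 ^ (1 - 2 * tow l), and tow l
    > l. *)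
Lemma sample_size_large l :
  (tow l.+1)%:R * (2 * expR (- ((sample_size l)%:R * (slack eps l ^+ 2 / 8))))
    <= delta / 2 ^+ l.+1.
Proof.
have /andP[d0 d1] := delta_itv; have /andP[sl0 _] := slack_itv eps01 l.
have h : ln (1 / delta) + 3 * (tow l)%:R <=
    (sample_size l)%:R * (slack eps l ^+ 2 / 8).
  have := sample_size_ge l; rewrite /sample_bound.
  have q0 : 0 < slack eps l ^+ 2 / 8 by rewrite divr_gt0 // exprn_gt0.
  move/(ler_wpM2r (ltW q0)); apply: le_trans.
  rewrite le_eqVlt; apply/orP; left; apply/eqP.
  by field; rewrite gt_eqF.
have : expR (- ((sample_size l)%:R * (slack eps l ^+ 2 / 8))) <=
    delta * 2 ^- (3 * tow l).
  apply: (@le_trans _ _ (expR (- (ln (1 / delta) + 3 * (tow l)%:R)))).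
    by rewrite ler_expR lerN2.
  rewrite opprD expRD div1r lnV ?posrE // opprK lnK ?posrE //.
  rewrite ler_pM2l //; have := expRN_le_exp2 (3 * tow l).
  by rewrite natrM.
move=> h2; apply: (@le_trans _ _
    ((2 ^ tow l)%:R * (2 * (delta * 2 ^- (3 * tow l))))).
  by apply: ler_wpM2l; [rewrite ler0n | apply: ler_wpM2l].
rewrite natrX mulrCA mulrA -exprS mulrCA ler_pM2l // ler_pdivrMr ?exprn_gt0 //.
rewrite mulrC ler_pdivlMr ?exprn_gt0 // -exprD ler_eXn2l ?ltr1n //.
by have := ltn_tow l; lia.
Qed.

Lemma slack_sqr l : 8 / slack eps l ^+ 2 = 128 * 4 ^+ l / eps ^+ 2.
Proof.
have /andP[e0 _] := eps01.
rewrite /slack (_ : 4 = 2 ^+ 2 :> R); last by rewrite -natrX.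
rewrite -exprM mulnC exprM !exprS.
by field; rewrite gt_eqF //= ?gt_eqF ?exprn_gt0.
Qed.

(** Level j takes about 4 ^ j * tow j pulls for each of at most 2 * K / grp j rivals; by
    [exp8_tow_le_grp] this is of order K / 2 ^ j, a geometric series. *)
Lemma cost_le K K' L u : (K' <= K)%N -> (forall j, (j < L)%N -> (grp j < K)%N) ->
  (cost K' sample_size L u)%:R <=
  2 * (64 * 1800) * (K%:R / eps ^+ 2 * ln (1 / delta)) :> R.
Proof.
move=> KK HL; set Q := (K%:R / eps ^+ 2 * ln (1 / delta)).
have /andP[e0 e1] := eps01; have la := lnV_delta_ge.
have Q0 : 0 <= Q.
  by rewrite /Q; apply: mulr_ge0; [rewrite divr_ge0 // sqr_ge0 | lra].
have term j : (j < L)%N ->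
    (sample_size j * rivals K' (grp j) u)%:R <= 64 * 1800 * Q * 2 ^- j.
  move=> /HL gK; rewrite natrM.
  set S : R := (sample_size j)%:R; set r : R := (rivals K' (grp j) u)%:R.
  set t : R := (tow j)%:R; set g : R := (grp j)%:R.
  have t1 : 1 <= t by rewrite ler1n tow_gt0.
  have g0 : 0 < g by rewrite ltr0n grp_gt0.
  (* Counting an incomplete group as whole adds less than one group, which is shorter than [K]. *)
  have rg : r * g <= 2 * K%:R.
    rewrite -!natrM ler_nat.
    have := leq_trunc_div (minn K' u + (grp j).-1) (grp j).
    rewrite -/(rivals K' (grp j) u); have := grp_gt0 j; lia.
  have tg : 8 ^+ j * t <= 64 * g.
    by rewrite -natrX -!natrM ler_nat exp8_tow_le_grp.
  (* 900 covers 128 * 7 + 2: as ln (1 / delta) >= 1 / 2, the term 3 * t and the rounding up are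
     absorbed. *)
  have Sle : S <= 900 * (4 ^+ j * t * ln (1 / delta) / eps ^+ 2).
    apply: le_trans (sample_size_le j) _; rewrite /sample_bound slack_sqr.
    set c : R := 4 ^+ j / eps ^+ 2.
    have c1 : 1 <= c.
      rewrite /c ler_pdivlMr ?exprn_gt0 // mul1r.
      apply: (@le_trans _ _ 1); first by rewrite expr_le1 ?ltW.
      by rewrite exprn_ege1 // ler1n.
    rewrite -/t (_ : 128 * 4 ^+ j / eps ^+ 2 = 128 * c); last first.
      by rewrite mulrA.
    rewrite (_ : 4 ^+ j * t * _ / _ = c * (t * ln (1 / delta))); last first.
      by rewrite /c; ring.
    have h1 : ln (1 / delta) + 3 * t <= 7 * (t * ln (1 / delta)) by nra.
    have h2 : 1 / 2 <= t * ln (1 / delta) by nra.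
    nra.
  have r0 : 0 <= r by rewrite ler0n.
  apply: le_trans (ler_wpM2r r0 Sle) _.
  have tr : 8 ^+ j * (t * r) <= 128 * K%:R.
    rewrite -(ler_pM2r g0).
    rewrite [leLHS](_ : _ = (8 ^+ j * t) * (r * g)); last by ring.
    rewrite [leRHS](_ : _ = (64 * g) * (2 * K%:R)); last by ring.
    by apply: ler_pM => //; rewrite mulr_ge0 ?ler0n ?exprn_ge0 // ltW.
  rewrite ler_pdivlMr ?exprn_gt0 //.
  rewrite [leLHS](_ : _ =
      900 * ((8 ^+ j * (t * r)) * (ln (1 / delta) / eps ^+ 2))); last first.
    by rewrite (_ : 8 = 4 * 2 :> R) ?exprMn; [ring|rewrite -natrM].
  rewrite [leRHS](_ : _ =
      900 * ((128 * K%:R) * (ln (1 / delta) / eps ^+ 2))); last first.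
    by rewrite /Q; ring.
  apply: ler_wpM2l; first by rewrite ler0n.
  apply: ler_wpM2r tr; apply: divr_ge0 (sqr_ge0 _).
  by apply: le_trans la; apply: divr_ge0; rewrite ?ler01 ?ler0n.
rewrite /cost natr_sum.
apply: (@le_trans _ _ (\sum_(j < L) 64 * 1800 * Q * 2 ^- j)).
  by apply: ler_sum => j _; exact: term.
rewrite -mulr_sumr.
have -> : \sum_(j < L) 2 ^- j = 2 * (1 - 2 ^- L) :> R.
  elim: (L) => [|m IH]; first by rewrite big_ord0 expr0 invr1 subrr mulr0.
  by rewrite big_ord_recr /= IH (exp2S _ m); ring.
have /andP[h1 h2] := exp2_itv R L.
have c0 : 0 <= 64 * 1800 :> R by rewrite mulr_ge0 ?ler0n.
by move: (64 * 1800) c0 => c c0; have := mulr_ge0 c0 Q0; nra.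
Qed.

End sample_sizes.

(** * Restriction to a random block *)

Section random_block.
Variables (R : realType) (n : nat).
Local Notation arm := ('I_n.+1).

Fixpoint skip (d : nat) (k : prog R n.+1) : prog R n.+1 :=
  if d is d'.+1 then perform Next (skip d' k) else k.

(* Discarding an arm which is not stored has no effect: it only gives the
   opportunity for a coin toss. *)
Fixpoint uniform (m : nat) (k : nat -> prog R n.+1) : prog R n.+1 :=
  if m is m'.+1 then Node (Discard ord0) (m.+1%:R^-1) (k m) (uniform m' k)
  else k 0.

(** The last block is cut at the end of the stream. The final [skip] is there because answers are
    accepted only once the stream has ended. *)
Definition block (K : nat) (s : nat -> nat) (j : nat) : prog R n.+1 :=
  let o := (j * K)%N in let K' := minn K (n.+1 - o) in
  skip o (tournament o K' s (height K) 0
    (fun a => skip (n.+1 - (o + K')) (Leaf (Some a)))).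

(* The blocks are numbered from 0 to n %/ K = ceil((n + 1) / K) - 1. *)
Definition random_block (K : nat) (s : nat -> nat) : prog R n.+1 :=
  uniform (n %/ K) (block K s).

Variable nu : arm -> probability R R.
Variable E : set (env n.+1).
Local Notation V := (fun w s => tree_val nu w s E).
Local Notation state t M pk q := (@Env n.+1 t M pk q None).

Lemma val_skip d t (M : {set arm}) pk q k : (t + d <= n.+1)%N ->
  V (state t M pk q) (skip d k) = V (state (t + d)%N M pk q) k.
Proof.
elim: d t => [|d IH] t td; first by rewrite addn0.
rewrite [skip _ _]/= val_perform [env_step _ _]/= ifT; last by lia.
by rewrite IH ?addSnnS // -addSnnS.
Qed.

Lemma val_uniform m k :
  V (env0 n.+1) (uniform m k) =
  m.+1%:R^-1 * \sum_(j < m.+1) V (env0 n.+1) (k j).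
Proof.
elim: m => [|m IH]; first by rewrite big_ord1 invr1 mul1r.
rewrite big_ord_recr /=.
have -> : (finset.set0 :\ ord0)%SET = finset.set0 :> {set arm}.
  by rewrite finset.set0D.
rewrite -/(env0 _) IH chance_no_pull //; last first.
  by rewrite invr_ge0 ler0n invf_le1 ?ltr0n // ler1n.
rewrite -[m.+2%:R]natr1; field.
by rewrite [1 + _]addrC !natr1 !pnatr_eq0.
Qed.

Section one_block.
Variables (K : nat) (s : nat -> nat) (j : nat) (v x : R) (G : arm -> Prop).
Hypothesis K0 : (0 < K)%N.
Hypothesis jK : (j * K < n.+1)%N.
Local Notation o := (j * K)%N.
Local Notation K' := (minn K (n.+1 - o)).
Local Notation L := (height K).
Hypothesis v1 : v <= 1.
Hypothesis found : finds nu E o K' L.+1 (cost K' s L) (grp L)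
  (@tournament R n o K' s L) 0 G x.
Hypothesis leafP : forall a pk q, G a -> (pk <= L.+1)%N ->
  (q <= cost K' s L (grp L))%N -> v <= \1_E (Env n.+1 [set a]%SET pk q (Some a)).

Lemma val_block : v - x <= V (env0 n.+1) (block K s j).
Proof.
have oK : (o + K' <= n.+1)%N by lia.
rewrite /block /env0 val_skip ?add0n; last by lia.
have c0 : clock o K' 0 = o by rewrite /clock; lia.
rewrite -{1}c0; apply: (found (B := L.+1)) => //.
- by move=> z; rewrite finset.inE.
- by rewrite cards0.
move=> a pk q _ _ pkL hq Ga.
have cL : clock o K' (0 + grp L) = (o + K')%N.
  by rewrite /clock add0n; have := leq_grp_height K; lia.
rewrite cL val_skip ?subnKC // finset.setU0 /= eqxx finset.inE eqxx /=.
by apply: leafP => //; move: hq; rewrite !add0n => <-; rewrite leq_addr.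
Qed.

End one_block.
End random_block.

(** * The algorithm and its guarantees *)

Section main.
Variables (R : realType) (n : nat) (eps delta : R).

Definition block_size : nat :=
  minn n.+1 (Num.truncn (4 * (1 - delta) * n.+1%:R)).+1.

(** The cap keeps ln (1 / confidence) away from 0; for larger delta the choice of the block uses up
    the difference. *)
Definition confidence : R := Num.min delta (1 / 2).

Definition bandit_prog : prog R n.+1 :=
  random_block R n block_size (sample_size eps confidence).

Hypothesis eps01 : 0 < eps < 1.
Hypothesis delta01 : 0 < delta < 1.
Local Notation K := block_size.
Local Notation s := (sample_size eps confidence).
Local Notation L := (height K).

Lemma block_size_gt0 : (0 < K)%N.
Proof. by rewrite /block_size leq_min. Qed.

Lemma block_size_le : (K <= n.+1)%N.
Proof. exact: geq_minl. Qed.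

Lemma confidence_itv : 0 < confidence <= 1 / 2.
Proof.
have /andP[d0 _] := delta01.
by rewrite /confidence lt_min d0 ge_min lexx orbT andbT /=; lra.
Qed.

(** With a single block, confidence <= delta suffices. Otherwise K > 4 * (1 - delta) * n for n arms,
    and there are at most 2 * n / K blocks, hence at most 1 / (2 * (1 - delta)); a success
    probability of 1 / 2 inside the block is enough. *)
Lemma blocks_confidence :
  1 - delta <= (n %/ K).+1%:R^-1 * (1 - confidence).
Proof.
have /andP[d0 d1] := delta01; have K0 := block_size_gt0.
rewrite mulrC ler_pdivlMr ?ltr0n //.
have [KN|KN] := eqVneq K n.+1.
  by rewrite KN divn_small // mulr1 lerD2l lerN2 ge_min lexx.
have hK : 4 * (1 - delta) * n.+1%:R < K%:R.
  move: KN; rewrite /block_size; set t := (Num.truncn _).+1.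
  have [h|h _] := leqP n.+1 t; first by rewrite eqxx.
  exact: truncnS_gt.
have c2 : confidence <= 1 / 2 by rewrite ge_min lexx orbT.
have bK : (n %/ K).+1%:R * K%:R <= 2 * n.+1%:R :> R.
  rewrite -!natrM ler_nat mulSn; have := leq_trunc_div n K.
  have := block_size_le; lia.
have b1 : 1 <= (n %/ K).+1%:R :> R by rewrite ler1n.
have N0 : 0 < n.+1%:R :> R by rewrite ltr0n.
set b := (n %/ K).+1%:R in bK b1 *; set N := n.+1%:R in hK bK N0.
have : (1 - delta) * b * N <= 1 / 2 * N.
  have := ler_wpM2l (le_trans ler01 b1) (ltW hK); nra.
by rewrite ler_pM2r //; lra.
Qed.

(** For delta > 1 / 2, [K] is of order (1 - delta) * n and 1 - delta <= ln (1 / delta). When [K]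
    exceeds 1, rounding up at most doubles it. *)
Lemma cost_confidence : (1 < K)%N ->
  K%:R * ln (1 / confidence) <= 8 * (n.+1%:R * ln (1 / delta)).
Proof.
have /andP[d0 d1] := delta01; move=> K1.
have N0 : 0 < n.+1%:R :> R by rewrite ltr0n.
have KN : K%:R <= n.+1%:R :> R by rewrite ler_nat block_size_le.
have l0 := ln1_ge d0.
rewrite /confidence; have [h|h] := leP delta (1 / 2); first nra.
have ln2_1 : ln (1 / (1 / 2)) <= 1 :> R.
  rewrite !div1r invrK; have := @le_ln1Dx R 1; rewrite -natr1; apply; lra.
have hK : K%:R <= 8 * (1 - delta) * n.+1%:R.
  set z := 4 * (1 - delta) * n.+1%:R.
  have z0 : 0 <= z by rewrite !mulr_ge0 ?ler0n // subr_ge0 ltW.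
  have z1 : 1 <= z.
    rewrite -[1]/(1%:R) -truncn_ge_nat //.
    by move: K1; rewrite /block_size leq_min => /andP[].
  have : K%:R <= z + 1.
    apply: (@le_trans _ _ (Num.truncn z).+1%:R).
      by rewrite ler_nat geq_minr.
    by rewrite -natr1 lerD2r truncn_le.
  by rewrite /z in z1 *; lra.
have K0 : 0 <= K%:R :> R by rewrite ler0n.
nra.
Qed.

Variable nu : 'I_n.+1 -> probability R R.
Hypothesis nu01 : forall i, nu i [set` `[0%R, 1%R]] = 1%E.

Lemma block_start (j : nat) : (j < (n %/ K).+1)%N -> (j * K < n.+1)%N.
Proof.
rewrite !ltnS => jK; apply: leq_trans (leq_trunc_div n K).
by rewrite leq_mul2r jK orbT.
Qed.

(** The bounds hold with probability 1 because [tournament_finds] has risk 0. A block of one arm has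
    height 0 and needs no pull, so rounding [K] up to 1 costs nothing. *)
Lemma bandit_prog_resources (E : set (env n.+1)) :
  (forall w, output w <> None -> (peak w <= L.+1)%N ->
     (L = 0%N /\ pulls w = 0%N \/ (1 < K)%N /\
     (pulls w)%:R <= 2 * (64 * 1800) * (K%:R / eps ^+ 2 * ln (1 / confidence))) ->
     E w) ->
  1 <= tree_val nu (env0 n.+1) bandit_prog E.
Proof.
move=> HE; have K0 := block_size_gt0.
rewrite val_uniform // mulrC ler_pdivlMr ?ltr0n // mul1r.
rewrite -[leLHS](_ : \sum_(j < (n %/ K).+1) 1 = (n %/ K).+1%:R); last first.
  by rewrite sumr_const card_ord.
apply: ler_sum => j _; rewrite -[leLHS]subr0.
have jK := block_start (ltn_ord j).
apply: (val_block (G := fun=> True)) => //.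
  by apply: tournament_finds => //; lia.
move=> a pk q _ pkL qL; rewrite indicE mem_set //; apply: HE => //=.
have [K1|K1] := ltnP 1 K; [right|left].
  split => //; apply: (@le_trans _ _
    (cost (minn K (n.+1 - j * K)) s L (grp L))%:R); first by rewrite ler_nat.
  apply: (cost_le eps01 confidence_itv _ (geq_minl _ _)) => l; exact: grp_lt.
have L0 : L = 0%N.
  by apply/eqP; rewrite -leqn0 leqNgt; apply/negP => /grp_lt /=; lia.
by split => //; move: qL; rewrite L0 /cost big_ord0 leqn0 => /eqP.
Qed.

(** Only the block containing [best] is credited; there [best] has relative position [best %% K].
    The losses over all levels sum to less than eps and the risks to less than [confidence]. *)
Lemma bandit_prog_best (E : set (env n.+1)) (best : 'I_n.+1) :
  (forall w a, output w = Some a -> mean (nu best) - eps <= mean (nu a) -> E w) ->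
  1 - delta <= tree_val nu (env0 n.+1) bandit_prog E.
Proof.
move=> HE; have K0 := block_size_gt0.
apply: le_trans blocks_confidence _.
rewrite val_uniform // ler_pM2l ?invr_gt0 ?ltr0n //.
have jb : (best %/ K < (n %/ K).+1)%N.
  by rewrite ltnS leq_div2r // -ltnS.
rewrite (bigD1 (Ordinal jb)) //= -[leLHS]addr0; apply: lerD; last first.
  apply: sumr_ge0 => i _.
  by have /andP[] := tree_val_itv nu (env0 n.+1) (block R n K s i) E.
have jK := block_start jb.
set j := (best %/ K)%N in jK *.
have bE := divn_eq best K; have bK := ltn_pmod best K0.
have bn := ltn_ord best.
have /andP[c0 c2] := confidence_itv.
apply: (@le_trans _ _ (1 - risk confidence L)).
  rewrite lerD2l lerN2 /risk; have /andP[h _] := exp2_itv R L.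
  by rewrite ler_piMr ?ltW // gtrBl.
apply: (val_block (G := good_enough nu (j * K) (best %% K) eps L)) => //.
  have best_lt : (best %% K < minn K (n.+1 - j * K))%N.
    by rewrite leq_min bK /= ltn_subRL -bE.
  apply: (tournament_finds_good nu01 _ _ eps01 _ _
    (sample_size_large eps01 confidence_itv)) => //.
    by lia.
  by rewrite add0n (leq_trans bK) // leq_grp_height.
move=> a pk q Ga _ _; rewrite indicE mem_set //; apply: (HE _ a) => //.
apply: le_trans Ga; rewrite -bE inord_val lerD2l lerN2.
have /andP[e0 e1] := eps01; have /andP[h _] := exp2_itv R L.
by rewrite ler_piMr ?ltW // gtrBl.
Qed.

End main.

Definition bandit_alg (R : realType) (n : nat) (eps delta : R) :
    streaming_alg R n :=
  if n is n'.+1 then tree_alg (bandit_prog n' eps delta)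
  else tree_alg (Leaf None).

Theorem theorem4 (R : realType) :
  exists (A : forall n : nat, R -> R -> streaming_alg R n) (C : R),
    0 < C /\
    forall (n : nat) (eps delta : R)
      (nu : 'I_n -> probability R R) (sigma : {perm 'I_n}),
    (0 < n)%N -> 0 < eps < 1 -> 0 < delta < 1 ->
    (forall i, nu i [set` `[0%R, 1%R]] = 1%E) ->
    exists T : nat,
      let law := run (fun t => nu (sigma t)) T (env0 n)
                   (alg_init (A n eps delta)) in
      law [set w | output w <> None /\
                   (peak w)%:R <= C * (maxn 1 (logstar R n))%:R /\
                   (pulls w)%:R <= C * (n%:R / eps ^+ 2 * ln (1 / delta))]
        = 1%E /\
      ((1 - delta)%:E <=
       law [set w | exists2 t, output w = Some t
                             & eps_best nu eps (sigma t)])%E.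
Proof.
have [c [c1 cE]] : exists c : R, 1 <= c /\ 2 * (64 * 1800) = c.
  by exists (2 * (64 * 1800)); split; rewrite ?mulr_ege1 ?ler1n.
(* [c] comes from [cost_le] and 8 from [cost_confidence]; memory only needs the factor 2 that
   absorbs the extra cell. *)
exists (@bandit_alg R), (8 * c); split; first by lra.
move=> [//|n] eps delta nu sigma _ eps01 delta01 nu01.
have nus01 i : nu (sigma i) [set` `[0%R, 1%R]] = 1%E by exact: nu01.
have /andP[e0 e1] := eps01; have /andP[d0 d1] := delta01.
pose p := bandit_prog n eps delta.
(* The additional step carries out the answer. *)
exists (depth p).+1 => law; split.
  apply/eqP; rewrite eq_le; apply/andP; split; first exact: run_le1.
  apply: le_trans (tree_val_le_run _ _ _ _ (ltnSn (depth p))).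
  rewrite lee_fin; apply: (bandit_prog_resources eps01 delta01 nus01).
  move=> w wo wpeak wpulls; split=> //; split.
    apply: (@le_trans _ _ (2 * (maxn 1 (logstar R n.+1))%:R)).
      rewrite -natrM ler_nat; apply: leq_trans wpeak _.
      by have := height_le_logstar R (block_size_le n delta); lia.
    by apply: ler_wpM2r; [rewrite ler0n | lra].
  have l0 : 0 <= ln (1 / delta) by have := ln1_ge d0; lra.
  have q0 : 0 <= (eps ^+ 2)^-1 by rewrite invr_ge0 sqr_ge0.
  case: wpulls => [[_ ->]|[K1 hp]].
    by rewrite !mulr_ge0 // ?ler0n //; lra.
  apply: le_trans hp _; rewrite cE [8 * c]mulrC -[leRHS]mulrA.
  apply: ler_wpM2l; first by lra.
  rewrite mulrAC.
  rewrite [leRHS](_ : _ = 8 * (n.+1%:R * ln (1 / delta)) / eps ^+ 2).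
    exact: ler_wpM2r (cost_confidence delta01 K1).
  by ring.
have [best bestP] : exists best : 'I_n.+1,
    forall j, mean (nu (sigma j)) <= mean (nu (sigma best)).
  exists [arg max_(i > ord0) mean (nu (sigma i))]%O.
  by case: arg_maxP => // i _ h j; exact: h.
apply: le_trans (tree_val_le_run _ _ _ _ (ltnSn (depth p))).
rewrite lee_fin; apply: (bandit_prog_best eps01 delta01 nus01 (best := best)).
move=> w a wa ha; exists a => //; rewrite /eps_best lerBlDr.
have hb j : mean (nu j) <= mean (nu (sigma a)) + eps.
  rewrite -lerBlDr; apply: le_trans ha; rewrite lerD2r.
  by have := bestP (sigma^-1 j)%g; rewrite permKV.
apply/bigmax_leP; split; last by move=> j _; exact: hb.
by rewrite lerDl ltW.
Qed.
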